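(* Let $t \ge 1$, $h \ge 1$ and $q \ge 1$ be integers, and let $G$ be a finite connected graph of girth $g \ge 4h(t+1)-3$ and with $(h,q)$-growth. Then $c(G) > \frac{1}{e\,t}\,q^{t}$, where $c(G)$ is the cop number of $G$ and $e$ is the base of the natural logarithm.
   Context: The game of cops and robbers is played with perfect information on a finite connected (undirected) graph $G$. The first player controls a team of cops, the second player controls one robber. First the first player places each cop on a vertex (several cops may share a vertex), then the second player places the robber on a vertex. The players then alternate turns, the first player moving first. On her turn the first player moves each cop to a vertex of its closed neighborhood (each cop may stay put or move to an adjacent vertex); on his turn the second player moves the robber to a vertex of the closed neighborhood of its current vertex. The first player wins if at some point a cop occupies the same vertex as the robber; the second player wins if the robber avoids this forever. The cop number $c(G)$ is the smallest number of cops for which the first player has a winning strategy on $G$. The girth of a graph is the length of its shortest cycle. Given positive integers $h,q$, a graph $G$ has $(h,q)$-growth if for every vertex $v \in V(G)$ and every neighbor $u$ of $v$, the number of vertices $w$ satisfying $\mathrm{dist}(w,v)=h$ and $\mathrm{dist}(w,u)\ge h$ is at least $q$. *)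

(* Defs.v *)
From mathcomp Require Import all_boot.
From mathcomp Require Import boolp.

Set Implicit Arguments.
Unset Strict Implicit.
Unset Printing Implicit Defensive.

Section Graph.
Variables (T : finType) (e : rel T).

Definition simple_graph : Prop := symmetric e /\ irreflexive e.

Definition connected_graph : Prop := forall x y : T, connect e x y.

Definition is_graph_cycle (c : seq T) : bool := ucycleb e c && (2 < size c).

(* [is_girth g] forces a cycle to exist: no acyclic graph has a girth here. *)
Definition is_girth (g : nat) : Prop :=
  (exists2 c : seq T, is_graph_cycle c & size c = g) /\
  (forall c : seq T, is_graph_cycle c -> g <= size c).

Definition walk_of_length (x y : T) (n : nat) : bool :=
  [exists p : n.-tuple T, path e x p && (last x p == y)].

(* The value is #|T| if x and y are not connected; this is harmless, as only
   connected graphs are considered (see [walk_dist] and [dist_min]). *)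
Definition dist (x y : T) : nat := find (walk_of_length x y) (iota 0 #|T|).

Definition has_growth (h q : nat) : Prop :=
  forall v u : T, e v u ->
    q <= #|[set w : T | (dist w v == h) && (h <= dist w u)]|.

Definition closed_nbr (x y : T) : bool := (x == y) || e x y.

(* [C s] is the position of the k cops once the robber has successively occupied
   the vertices listed in s and the cops have answered the last of them;
   [C [::]] is the initial placement. The cops' moves being determined by the
   strategy, the robber's positions carry the whole history of the game. *)
Definition cop_strategy (k : nat) := seq T -> 'I_k -> T.

Definition legal_strategy (k : nat) (C : cop_strategy k) : Prop :=
  forall (s : seq T) (x : T) (i : 'I_k), closed_nbr (C s i) (C (rcons s x) i).

(* [r 0] is the robber's initial placement, [r n] his position after n moves. *)
Definition legal_robber (r : nat -> T) : Prop :=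
  forall n : nat, closed_nbr (r n) (r n.+1).

(* While the robber is on [r n], the cops are first at [C (mkseq r n)] and then,
   after their next move, at [C (mkseq r n.+1)]. *)
Definition captures (k : nat) (C : cop_strategy k) (r : nat -> T) : Prop :=
  exists (n : nat) (i : 'I_k), C (mkseq r n) i = r n \/ C (mkseq r n.+1) i = r n.

Definition cops_win (k : nat) : Prop :=
  exists2 C : cop_strategy k, legal_strategy C &
    forall r : nat -> T, legal_robber r -> captures C r.

Lemma ex_cops_win : exists k : nat, `[< cops_win k >].
Proof.
exists #|T|; apply/asboolP; exists (fun _ i => enum_val i).
  by move=> s x i; rewrite /closed_nbr eqxx.
by move=> r _; exists 0, (enum_rank (r 0)); left; rewrite enum_rankK.
Qed.

Definition cop_number : nat := ex_minn ex_cops_win.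

Lemma walk_of_lengthP (x y : T) (n : nat) :
  reflect (exists p : seq T, [/\ path e x p, last x p = y & size p = n])
          (walk_of_length x y n).
Proof.
apply: (iffP existsP) => [[p /andP[xp /eqP <-]]|[p [xp <- /eqP sp]]].
  by exists p; rewrite size_tuple.
by exists (Tuple sp); rewrite xp eqxx.
Qed.

Lemma walk_dist (x y : T) : connect e x y -> walk_of_length x y (dist x y).
Proof.
case/connectP=> p xp ->; case/shortenP: xp => p' xp' up' _.
have ltp' : size p' < #|T| by rewrite -[_.+1]/(size (x :: p')) -(card_uniqP up') max_card.
have hasw : has (walk_of_length x (last x p')) (iota 0 #|T|).
  apply/hasP; exists (size p'); first by rewrite mem_iota.
  by apply/walk_of_lengthP; exists p'.
have := nth_find 0 hasw; rewrite nth_iota //.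
by move: hasw; rewrite has_find size_iota.
Qed.

Lemma dist_min (x y : T) (n : nat) : walk_of_length x y n -> dist x y <= n.
Proof.
move=> wn; rewrite leqNgt; apply/negP => lt_n.
have := before_find 0 lt_n; rewrite nth_iota ?wn //.
by apply: leq_trans lt_n _; rewrite -[leqRHS](size_iota 0) find_size.
Qed.

End Graph.

(* Main.v *)
Require Import Defs.
From mathcomp Require Import all_boot all_order all_algebra.
From mathcomp Require Import boolp reals sequences exp.
From mathcomp Require Import zify.

Set Implicit Arguments.
Unset Strict Implicit.
Unset Printing Implicit Defensive.

Import Order.TTheory GRing.Theory Num.Theory.

(* The robber moves in rounds of [h] steps, along geodesics that never turn back
   to his previous vertex [u]. By the girth hypothesis, a cop [x] at distance
   [D <= 2h(t+1)-2] from the robber's vertex [v] is seen as in a tree. If [x] is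
   in front ([D <= dist u x]), at most one of the [>= q] possible rounds leads
   towards [x] and lowers [D] by at most [2h]; after every other round [x] is
   behind the robber or at distance at least [2ht-1]. So a cop in front gets the
   weight [mu * theta ^ a], [a = (D + 1) %/ 2h], where [mu = exp (-1/t)] and
   [q * mu * theta = 1]: averaging over the rounds, the total weight is multiplied
   by [mu], up to cops coming newly in front, which weigh at most
   [mu * theta ^ t] each. With [k <= q^t / (e t)] cops the total weight thus
   stays below [1], which always leaves a round in which no cop can intercept.
   For the initial position, the cops are imagined to start on a single
   neighbour of the robber, and to walk from there to their true placement. *)

(** * Metric properties of [dist] on a connected graph *)

Section Distance.
Variables (T : finType) (e : rel T).
Hypotheses (e_simple : simple_graph e) (e_conn : connected_graph e).

Let e_sym : symmetric e := e_simple.1.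

Lemma dist_le_path x p : path e x p -> dist e x (last x p) <= size p.
Proof. by move=> xp; apply/dist_min/walk_of_lengthP; exists p. Qed.

Lemma geodesic_ex x y :
  exists p, [/\ path e x p, last x p = y & size p = dist e x y].
Proof. exact/walk_of_lengthP/walk_dist/e_conn. Qed.

Lemma dist_triangle y x z : dist e x z <= dist e x y + dist e y z.
Proof.
have [p [xp <- <-]] := geodesic_ex x y.
have [r [yr <- <-]] := geodesic_ex (last x p) z.
by rewrite -last_cat -size_cat dist_le_path // cat_path xp.
Qed.

Lemma dist_leC x y : dist e y x <= dist e x y.
Proof.
have [p [xp <- <-]] := geodesic_ex x y.
have := @dist_le_path (last x p) (rev (belast x p)).
rewrite size_rev size_belast rev_path (eq_path (e' := e)) //.
by move=> /(_ xp); case: p {xp} => //= a p; rewrite rev_cons last_rcons.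
Qed.

Lemma dist_sym x y : dist e x y = dist e y x.
Proof. by apply/eqP; rewrite eqn_leq !dist_leC. Qed.

Lemma dist_self x : dist e x x = 0.
Proof. by apply/eqP; rewrite -leqn0; apply: (@dist_le_path x [::]). Qed.

Lemma dist_edge x y : e x y -> dist e x y <= 1.
Proof. by move=> xy; apply: (@dist_le_path x [:: y]); rewrite /= xy. Qed.

Lemma dist_closed_nbr x y : closed_nbr e x y -> dist e x y <= 1.
Proof. by case/orP=> [/eqP <-|/dist_edge //]; rewrite dist_self. Qed.

Lemma dist_pos x y : x != y -> 0 < dist e x y.
Proof.
apply: contraNT; rewrite -eqn0Ngt => /eqP d0.
have [p [_ lp]] := geodesic_ex x y.
by rewrite d0 -lp => /size0nil ->.
Qed.

End Distance.

(** * Non-backtracking walks and their uniqueness below the girth *)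

Section NonBacktracking.
Variables (T : finType) (e : rel T).
Hypotheses (e_simple : simple_graph e).

Let e_sym : symmetric e := e_simple.1.

(** The walk is given by all its vertices, the first included; it may revisit a vertex, but never
    two steps after leaving it. *)
Fixpoint nbwalk (s : seq T) : bool :=
  if s is x :: s1 then
    if s1 is y :: s2 then
      [&& e x y, ohead s2 != Some x & nbwalk s1]
    else true
  else true.

Lemma nbwalk_cons x y s :
  nbwalk [:: x, y & s] = [&& e x y, ohead s != Some x & nbwalk (y :: s)].
Proof. by []. Qed.

(** The pieces overlap in two vertices, so any three consecutive vertices lie within one of them. *)
Lemma nbwalk_cat s a b s' :
  nbwalk (s ++ [:: a, b & s']) = nbwalk (s ++ [:: a; b]) && nbwalk [:: a, b & s'].
Proof.
elim: s => [|x [|y s] IHs]; first by rewrite /=; case: (e a b).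
  by rewrite /=; case: (e x a) (e a b) => [] []; rewrite ?andbT ?andbF.
rewrite !cat_cons !nbwalk_cons -!cat_cons IHs -!andbA.
by congr [&& _, _ & _]; case: (s).
Qed.

Lemma nbwalk_suffix s1 s2 : nbwalk (s1 ++ s2) -> nbwalk s2.
Proof.
elim: s1 => // x s1 IHs xs; apply: IHs; move: xs; rewrite cat_cons.
by case: (s1 ++ s2) => // y s; rewrite nbwalk_cons => /and3P[].
Qed.

Lemma nbwalk_prefix s1 s2 : nbwalk (s1 ++ s2) -> nbwalk s1.
Proof.
elim: s1 => // x [|y s1] IHs //; rewrite !cat_cons !nbwalk_cons.
by case/and3P=> -> xs /IHs ->; case: s1 xs {IHs} => //= z s1 ->.
Qed.

Lemma nbwalk_rev s : nbwalk (rev s) = nbwalk s.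
Proof.
elim: s => [|x [|y [|z s]] IHs] //; first by rewrite /= e_sym.
have -> : rev [:: x, y, z & s] = rev s ++ [:: z, y & [:: x]].
  by rewrite !rev_cons -!cats1 -!catA.
rewrite nbwalk_cat.
have -> : rev s ++ [:: z; y] = rev [:: y, z & s].
  by rewrite !rev_cons -!cats1 -!catA.
rewrite IHs (nbwalk_cons x) [nbwalk [:: z; _; _]]/= (e_sym z y) (e_sym y x) !andbT.
rewrite !(inj_eq Some_inj) (eq_sym z x) nbwalk_cons.
by case: (e y z); case: (e x y); rewrite ?andbF ?andbT //= [RHS]andbC.
Qed.


Lemma nbwalk_path x p : nbwalk (x :: p) -> path e x p.
Proof. by elim: p x => //= y p IHp x /and3P[-> _ /IHp]. Qed.

(** At the junction, the only possible backtrack is from the predecessor of [last x p] to [b]. *)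
Lemma nbwalk_join x p b s :
  nbwalk (x :: p) -> nbwalk [:: last x p, b & s] ->
  (forall p', p = rcons p' (last x p) -> last x p' != b) ->
  nbwalk (x :: p ++ b :: s).
Proof.
case/lastP: p => // p y; rewrite last_rcons => xp ybs /(_ p erefl).
rewrite cat_rcons; case/lastP: p xp => [|p z] xp.
  rewrite [last _ _]/= [[::] ++ _]/= => xb; rewrite nbwalk_cons ybs; move: xp; rewrite /= => /andP[-> _] /=.
  by rewrite (inj_eq Some_inj) eq_sym xb.
rewrite last_rcons => zb; move: xp; rewrite !cat_rcons -!cats1 -catA -!cat_cons => xp.
rewrite nbwalk_cat xp nbwalk_cons ybs (inj_eq Some_inj) eq_sym zb.
by have := nbwalk_suffix xp; rewrite /= => /andP[->].
Qed.

Hypothesis e_conn : connected_graph e.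

(** Cutting out a backtrack would shorten the path by two. *)
Lemma nbwalk_geodesic x p :
  path e x p -> size p <= dist e x (last x p) -> nbwalk (x :: p).
Proof.
elim: p x => // y p IHp x /= /andP[xy yp] px.
rewrite -/(nbwalk [:: x, y & p]) nbwalk_cons xy IHp //; last first.
  have := dist_triangle e_conn y x (last y p).
  by have := dist_edge xy; lia.
case: p yp px {IHp} => //= z p /andP[_ zp] px; rewrite andbT (inj_eq Some_inj).
by apply: contraTneq px => zx; have := dist_le_path zp; rewrite -zx; lia.
Qed.

Variable g : nat.
Hypothesis girth_ge : forall c, is_graph_cycle e c -> g <= size c.

(** If the first vertex recurs in the repetition-free tail, the part up to its return is a cycle
    shorter than [g]; irreflexivity and non-backtracking rule out lengths 1 and 2. *)
Lemma nbwalk_uniq s : nbwalk s -> size s <= g -> uniq s.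
Proof.
elim: s => // x s IHs xs ltg.
have us : uniq s by apply: IHs (ltnW ltg); apply: (nbwalk_suffix (s1 := [:: x])).
rewrite cons_uniq us andbT; apply: contraL ltg => x_s; rewrite -ltnNge.
case/splitPr: x_s us xs {IHs} => p1 p2 us xs.
suff: g <= size (x :: p1) by rewrite /= size_cat /=; lia.
apply: girth_ge.
rewrite /is_graph_cycle /ucycleb -andbA; apply/and3P; split.
- by have := nbwalk_path xs; rewrite -cat_rcons cat_path => /andP[].
- by move: us; rewrite -cat_rcons cat_uniq rcons_uniq => /andP[].
- case: p1 xs {us} => [|a [|b p1]] //; rewrite [_ ++ _]/= nbwalk_cons.
    by rewrite e_simple.2.
  by rewrite /= eqxx andbF.
Qed.

(** Common first steps are stripped off. Once the walks diverge, one reversed and followed by the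
    other is a closed non-backtracking walk with at most [g] vertices, against [nbwalk_uniq]. *)
Lemma nbwalk_inj x p1 p2 :
    nbwalk (x :: p1) -> nbwalk (x :: p2) -> last x p1 = last x p2 ->
  size p1 + size p2 < g -> p1 = p2.
Proof.
elim: p1 p2 x => [|a p1 IHp] [|b p2] x xp1 xp2 eq_last ltg //.
- have xb : x \in b :: p2 by rewrite [x in x \in _]eq_last /= mem_last.
  by have := nbwalk_uniq xp2 ltg; rewrite cons_uniq xb.
- have xa : x \in a :: p1 by rewrite [x in x \in _](esym eq_last) /= mem_last.
  by rewrite addn0 in ltg; have := nbwalk_uniq xp1 ltg; rewrite cons_uniq xa.
have [ab|nab] := eqVneq a b.
  move: (nbwalk_suffix (s1 := [:: x]) xp1) (nbwalk_suffix (s1 := [:: x]) xp2).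
  rewrite -{b}ab in ltg eq_last xp2 * => ap1 ap2; congr cons; apply: (IHp _ a) => //.
  by move: ltg => /=; lia.
have nbw : nbwalk (rev p1 ++ [:: a, x & b :: p2]).
  rewrite nbwalk_cat nbwalk_cons xp2 -nbwalk_rev rev_cat revK.
  rewrite -[rev [:: a; x]]/[:: x; a] [_ ++ _]/= xp1.
  by move: xp1; rewrite e_sym nbwalk_cons => /andP[-> _]; rewrite (inj_eq Some_inj) eq_sym nab.
have := nbwalk_uniq nbw; rewrite -cat_rcons -rev_cons cat_uniq => uw.
have : [&& uniq (rev (a :: p1)), ~~ has [in rev (a :: p1)] (x :: b :: p2) & uniq (x :: b :: p2)].
  by apply: uw; rewrite size_cat size_rev; move: ltg => /=; lia.
case/and3P=> _ /hasPn nh _; have := nh (last b p2).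
rewrite in_cons mem_last orbT => /(_ isT).
by rewrite /= mem_rev -[last b p2]/(last x (b :: p2)) -eq_last /= mem_last.
Qed.

(** The walk is compared with a geodesic between its ends: below the girth the two coincide. *)
Lemma nbwalk_dist x p :
  nbwalk (x :: p) -> size p = dist e x (last x p) \/ g <= size p + dist e x (last x p).
Proof.
move=> xp; have [r [xr lr sr]] := geodesic_ex e_conn x (last x p).
case: (leqP g (size p + dist e x (last x p))) => [|ltg]; [by right | left].
by rewrite (nbwalk_inj (p2 := r) xp) // ?sr ?nbwalk_geodesic ?lr ?sr.
Qed.

End NonBacktracking.

(** * Which cops can interfere with one round of the robber *)

Section CopGeometry.
Variables (T : finType) (e : rel T) (g h t : nat).
Hypotheses (e_simple : simple_graph e) (e_conn : connected_graph e).
Hypothesis girth_ge : forall c, is_graph_cycle e c -> g <= size c.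
Hypotheses (h_gt0 : 0 < h) (t_gt0 : 0 < t).
Hypothesis g_ge : 4 * h * t + 4 * h <= g + 3.

(** In the second case, [p1] -> [b] is the first step of [p] that does not approach [x]. *)
Lemma geodesic_split v p x : path e v p ->
  dist e (last v p) x + size p = dist e v x \/
  exists p1 b p2, [/\ p = p1 ++ b :: p2,
    dist e (last v p1) x + size p1 = dist e v x &
    (dist e b x).+1 != dist e (last v p1) x].
Proof.
elim: p v => [|b p IHp] v /=; first by left; rewrite addn0.
case/andP=> vb /IHp IH; have [vx|nvx] := eqVneq (dist e b x).+1 (dist e v x); last first.
  by right; exists [::], b, p; rewrite addn0.
case: IH => [eqd|[p1 [c [p2 [-> eqd nc]]]]]; first by left; lia.
by right; exists (b :: p1), c, p2; split=> //=; lia.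
Qed.

(* The robber, coming from [u], is about to walk along [p] from [v]: a cop
   standing on [x] cannot intercept him, and is then behind him or far away. *)
Definition avoids (u v : T) (p : seq T) (x : T) : Prop :=
  (forall j, j < size p -> j.+1 < dist e x (nth v p j)) /\
  (forall x', dist e x x' <= h ->
     dist e (last u (belast v p)) x' < dist e (last v p) x' \/
     2 * h * t <= (dist e (last v p) x').+1).

(** If [x'] is near [w], a geodesic from [w] to [x'] must start back through [last x a]; otherwise
    it would prolong the walk from [x] to a non-backtracking walk from [x] to [x'], too long to be a
    geodesic. *)
Lemma walk_escape x a w x' :
    nbwalk e (x :: rcons a w) -> h <= size a -> size a + 2 < 2 * h * t + 3 * h ->
    dist e x x' <= h ->
  dist e (last x a) x' < dist e w x' \/ 2 * h * t <= (dist e w x').+1.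
Proof.
move=> xaw ha ah xx'; case: (leqP (2 * h * t) (dist e w x').+1) => [|ltwx]; [by right | left].
have [b [wb lb sb]] := geodesic_ex e_conn w x'.
have nbwb : nbwalk e (w :: b) by rewrite nbwalk_geodesic // lb sb.
(* The girth bound is tight here: the length of this walk plus [dist e x x'] is at most
   [4ht + 4h - 4 < g], while the length alone exceeds [h]. *)
have far s : nbwalk e (x :: rcons a w ++ s) -> size s <= dist e w x' ->
    last w s = x' -> False.
  move=> xs ls lx; have := nbwalk_dist e_simple e_conn girth_ge xs.
  by rewrite last_cat last_rcons lx size_cat size_rcons; lia.
case: b => [|b1 b] in wb lb sb nbwb.
  by case: (far [::]); rewrite ?cats0.
have [ab|ab] := eqVneq (last x a) b1.
  by rewrite ab -sb -lb ltnS dist_le_path //; move: wb => /andP[].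
case: (far (b1 :: b)) => //; last by rewrite sb.
apply: nbwalk_join => //; first by rewrite last_rcons.
by move=> a'; rewrite last_rcons => /rcons_inj[<-].
Qed.

(** The robber approaches [x] along [p1] and branches off at [b]. As [2 * size p1 < D], he reaches
    the branching point before the cop; from there on the cop can only follow. *)
Lemma diverging_avoids u v x a p1 b p2 :
    path e v (p1 ++ b :: p2) -> size (p1 ++ b :: p2) = h ->
    nbwalk e (x :: a ++ b :: p2) -> last x a = last v p1 ->
    size a + size p1 = dist e v x -> dist e v x + 2 <= 2 * h * t + 2 * h ->
    2 * size p1 < dist e v x ->
  avoids u v (p1 ++ b :: p2) x.
Proof.
move=> vp sp xab la sa Dle Dgt.
have sp' : size p1 + (size p2).+1 = h by rewrite -sp size_cat.
have ht : 0 < h * t by rewrite muln_gt0 h_gt0.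
split=> [j ltj|x' xx'].
  have lj : nth v (p1 ++ b :: p2) j = last v (take j.+1 (p1 ++ b :: p2)).
    rewrite (last_nth v) size_take_min (minn_idPl ltj) /=.
    by rewrite nth_take.
  rewrite lj take_cat; case: (ltnP j.+1 (size p1)) => [ltj1|lej1].
    have := @take_path _ e _ _ j.+1 vp; rewrite take_cat ltj1 => /dist_le_path.
    rewrite size_take ltj1 => lev; have := dist_triangle e_conn (last v (take j.+1 p1)) v x.
    by rewrite (dist_sym e_simple e_conn x); lia.
  set s := take _ (b :: p2).
  have ss : size s = j.+1 - size p1.
    by rewrite size_take_min; apply/minn_idPl; rewrite /=; lia.
  have xas : nbwalk e (x :: a ++ s).
    by apply: (nbwalk_prefix (s2 := drop (j.+1 - size p1) (b :: p2))); rewrite cat_cons -catA cat_take_drop.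
  have := nbwalk_dist e_simple e_conn girth_ge xas.
  by rewrite !last_cat la size_cat ss; lia.
have -> : last v (p1 ++ b :: p2) = last b p2 by rewrite last_cat.
have -> : last u (belast v (p1 ++ b :: p2)) = last x (a ++ belast b p2).
  by rewrite belast_cat last_cat /= last_cat /= la; case: p2 {vp sp xab sp'}.
apply: walk_escape => //; try by rewrite size_cat size_belast; lia.
by rewrite rcons_cat -lastI.
Qed.

(** Here the branching point is [v] itself: [h <= dist e (last v p) u] prevents [p] from starting
    towards [u]. *)
Lemma behind_avoids u v p x :
    e u v -> path e v p -> size p = h -> h <= dist e v (last v p) ->
    h <= dist e (last v p) u ->
    dist e u x < dist e v x -> dist e v x + 2 <= 2 * h * t + 2 * h ->
  avoids u v p x.
Proof.
move=> uv vp sp vw wu ux Dle.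
have [a [xa la sa]] := geodesic_ex e_conn x u.
rewrite dist_sym // in sa.
have Dux : dist e v x = (dist e u x).+1.
  have := dist_triangle e_conn u v x.
  by have := dist_edge uv; rewrite dist_sym //; lia.
have xav : nbwalk e (x :: rcons a v).
  rewrite nbwalk_geodesic // ?last_rcons ?size_rcons ?rcons_path ?xa ?la //.
  by rewrite (dist_sym _ _ x) // Dux sa.
have nbp : nbwalk e (v :: p) by rewrite nbwalk_geodesic // sp.
case: p vp sp vw wu nbp => [|b p]; first by move=> _ /=; lia.
move=> vp sp vw wu nbp; apply: (@diverging_avoids _ _ _ (rcons a v) [::]) => //.
- apply: nbwalk_join => //; first by rewrite last_rcons.
  move=> a'; rewrite last_rcons => /rcons_inj[<-]; rewrite la.
  apply: contraTneq wu => ub; rewrite -ltnNge ub dist_sym //.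
  by move: vp sp => /= /andP[_ /dist_le_path]; lia.
- by rewrite last_rcons.
- by rewrite size_rcons sa addn0.
- by rewrite Dux.
Qed.

(** Since [p] does not lead towards [x] all the way, it branches off after at most [h - 1] steps,
    and [2 * (h - 1) < D]. *)
Lemma front_avoids u v p x :
    path e v p -> size p = h -> h <= dist e v (last v p) ->
    2 * h <= (dist e v x).+1 -> dist e (last v p) x + h <> dist e v x ->
    dist e v x + 2 <= 2 * h * t + 2 * h ->
  avoids u v p x.
Proof.
move=> vp sp vw Dge; rewrite -{1}sp => nwx Dle.
have nbp : nbwalk e (v :: p) by rewrite nbwalk_geodesic // sp.
case: (geodesic_split x vp) => // -[p1 [b [p2 [def_p yx bx]]]].
have [a [xa la sa]] := geodesic_ex e_conn x (last v p1).
rewrite dist_sym // in sa.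
have sp' : size p1 + (size p2).+1 = h by rewrite -sp def_p size_cat.
rewrite {}def_p in vp sp vw nbp *; apply: (@diverging_avoids _ _ _ a) => //; try by lia.
apply: nbwalk_join.
- by rewrite nbwalk_geodesic // la sa dist_sym.
- rewrite la; apply: (nbwalk_suffix (s1 := belast v p1)).
  by rewrite -cat_rcons -lastI.
move=> a' def_a; apply: contraNneq bx => <-.
move: xa sa; rewrite def_a la rcons_path size_rcons => /andP[xa' /dist_edge a'y] sa.
have := dist_le_path xa'; have := dist_triangle e_conn (last x a') (last v p1) x.
rewrite [dist e (last x a') x]dist_sym // [dist e (last v p1) (last x a')]dist_sym //.
by move: sa; lia.
Qed.

(** Cop and robber together reduce their distance by at most [2h] in a round. *)
Lemma far_avoids u v p x :
    path e v p -> size p = h -> 2 * h * t + 2 * h <= (dist e v x).+1 ->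
  avoids u v p x.
Proof.
move=> vp sp Dge; have ht : 0 < h * t by rewrite muln_gt0 h_gt0.
have vj j : j < size p -> dist e v (nth v p j) <= j.+1.
  move=> ltj; have := dist_le_path (@take_path _ e _ _ j.+1 vp).
  by rewrite size_take_min (minn_idPl ltj) (last_nth v) size_take_min (minn_idPl ltj) /= nth_take.
split=> [j ltj|x' xx']; last right.
  have := vj _ ltj; have := dist_triangle e_conn (nth v p j) v x.
  by rewrite (dist_sym _ _ x) //; lia.
have := dist_le_path vp; have := dist_triangle e_conn (last v p) v x.
have := dist_triangle e_conn x' (last v p) x; rewrite (dist_sym _ _ x') //.
by lia.
Qed.

(** Both vertices lie at step [h] of a geodesic from [v] to [x], which is unique because twice its
    length is at most [4ht + 4h - 4 < g]. *)
Lemma target_unique v w1 w2 x :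
    dist e w1 v = h -> dist e w2 v = h ->
    dist e w1 x + h = dist e v x -> dist e w2 x + h = dist e v x ->
    dist e v x + 2 <= 2 * h * t + 2 * h ->
  w1 = w2.
Proof.
have walk w : dist e w v = h -> dist e w x + h = dist e v x ->
    exists a b, [/\ nbwalk e (v :: a ++ b), size a = h, last v a = w,
       last w b = x & size b + h = dist e v x].
  move=> wv wx; have [a [va la sa]] := geodesic_ex e_conn v w.
  have [b [wb lb sb]] := geodesic_ex e_conn w x.
  have sa' : size a = h by rewrite sa dist_sym.
  exists a, b; split=> //; last by rewrite sb.
  rewrite nbwalk_geodesic ?cat_path ?va ?la //.
  by rewrite size_cat last_cat la lb sa' sb addnC wx.
move=> /walk W1 /walk W2 /W1[a1 [b1 [n1 sa1 <- lb1 sb1]]] /W2[a2 [b2 [n2 sa2 <- lb2 sb2]]] Dle.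
have /eqP : a1 ++ b1 = a2 ++ b2.
  apply: (nbwalk_inj e_simple girth_ge n1 n2).
    by rewrite !last_cat lb1 lb2.
  by rewrite !size_cat; lia.
by rewrite eqseq_cat ?sa1 // => /andP[/eqP -> _].
Qed.

End CopGeometry.

(** * From a safety invariant to an evading robber *)

Section Game.
Variables (T : finType) (e : rel T) (k : nat).

Definition cops_move (c c' : 'I_k -> T) : Prop :=
  forall i, closed_nbr e (c i) (c' i).

(** An invariant for the moments when the robber, on [v], is to move against cops placed by [c]. *)
Variable safe : T -> ('I_k -> T) -> Prop.
Hypothesis safe_step : forall v c, safe v c -> exists v',
  e v v' /\ forall c', cops_move c c' ->
    (forall i, c i != v' /\ c' i != v') /\ safe v' c'.

Lemma safe_reach x v (c : 'I_k -> T) : connected_graph e ->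
  safe v (fun=> x) -> exists v', safe v' c.
Proof.
move=> e_conn safe0.
have reach n (d : 'I_k -> T) : (forall i, dist e x (d i) <= n) -> exists v', safe v' d.
  elim: n d => [|n IHn] d dn.
    exists v; suff -> : d = (fun=> x) by [].
    apply: funext => i; apply/eqP; rewrite eq_sym; apply: contraLR (dn i).
    by rewrite -ltnNge; apply: dist_pos.
  (* [d'] draws each cop one step back towards [x]; after the robber's move from a position safe
     against [d'], the cops advance to [d]. *)
  have /fin_all_exists[d' d'P] i : exists y, dist e x y <= n /\ closed_nbr e y (d i).
    have [p [xp lp sp]] := geodesic_ex e_conn x (d i).
    case/lastP: p => [|p z] in xp lp sp.
      by exists x; rewrite dist_self -lp /closed_nbr eqxx.
    move: xp lp; rewrite rcons_path last_rcons => /andP[xp pz] <-.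
    exists (last x p); rewrite /closed_nbr pz orbT; split=> //.
    apply: leq_trans (dist_le_path xp) _.
    by rewrite -ltnS -(size_rcons p z) sp.
  have [v1 /safe_step[v2 [_]]] := IHn d' (fun i => (d'P i).1).
  by case/(_ d (fun i => (d'P i).2)) => _ safe2; exists v2.
by apply: (reach (\max_i dist e x (c i))) => i; apply: leq_bigmax.
Qed.

Lemma safe_evades v (C : cop_strategy T k) :
    legal_strategy e C -> safe v (C [::]) ->
  exists2 r, legal_robber e r & ~ captures C r.
Proof.
move=> legalC safe0.
(* [f] selects the robber's move; in unsafe positions its value is irrelevant. *)
have /choice[f fP] (vc : T * ('I_k -> T)) : exists v2, safe vc.1 vc.2 ->
    e vc.1 v2 /\ forall c', cops_move vc.2 c' ->
      (forall i, vc.2 i != v2 /\ c' i != v2) /\ safe v2 c'.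
  have [safe1|] := pselect (safe vc.1 vc.2); last by exists vc.1.
  by have [v2 v2P] := safe_step safe1; exists v2.
pose next (s : seq T * T) := f (s.2, C s.1).
pose H n := iter n (fun s => (rcons s.1 (next s), next s)) ([::], v).
(* The shift by one makes [v] an imaginary position before the game: the robber's actual placement
   [r 0] is his first move from [v]. *)
pose r n := (H n.+1).2.
have Hr n : (H n).1 = mkseq r n by elim: n => // n IHn; rewrite mkseqS -IHn.
have safeH n : safe (H n).2 (C (H n).1).
  elim: n => // n IHn.
  by have [_ /(_ (C (H n.+1).1) (legalC _ _))[]] := fP (_, _) IHn.
exists r => [n|[n [i]]].
  by rewrite /closed_nbr (fP ((H n.+1).2, _) (safeH n.+1)).1 orbT.
have [_ /(_ (C (H n.+1).1) (legalC _ _))[/(_ i)[/eqP free1 /eqP free2] _]] := fP (_, _) (safeH n).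
by rewrite -!Hr; case=> [/free1|/free2].
Qed.

Variable good : T -> T -> ('I_k -> T) -> Prop.

(* The robber, coming from [u], stands on [v] and can walk along [p] and end in
   a [good] position, however the cops move meanwhile. *)
Fixpoint plan (u v : T) (p : seq T) (c : 'I_k -> T) : Prop :=
  if p is w :: p' then
    e v w /\ forall c', cops_move c c' ->
      (forall i, c i != w /\ c' i != w) /\ plan v w p' c'
  else good u v c.

(** When the robber has entered [nth v p j] and the cops have answered, each cop has made [j + 1]
    moves, whence the strict bound. *)
Lemma plan_of_dist u v p c : simple_graph e -> connected_graph e ->
    path e v p ->
    (forall j i, j < size p -> j.+1 < dist e (c i) (nth v p j)) ->
    (forall c', (forall i, dist e (c i) (c' i) <= size p) ->
       good (last u (belast v p)) (last v p) c') ->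
  plan u v p c.
Proof.
move=> e_simple e_conn; elim: p u v c => [|w p IHp] u v c /=.
  by move=> _ _; apply=> i; rewrite dist_self.
case/andP=> vw wp cp goodp; split=> // c' cc'; split=> [i|].
  have ciw := cp 0 i isT; rewrite /= in ciw; split.
    by apply: contraTneq ciw => ->; rewrite dist_self.
  apply: contraTneq ciw => <-; rewrite -leqNgt.
  exact: dist_closed_nbr (cc' i).
apply: IHp => // [j i ltj|c2 c2P].
  have := cp j.+1 i ltj; rewrite /= (set_nth_default w) // => lt1.
  have := dist_triangle e_conn (c' i) (c i) (nth w p j).
  by have := dist_closed_nbr (cc' i); lia.
apply: goodp => i; have := dist_triangle e_conn (c' i) (c i) (c2 i).
by have := dist_closed_nbr (cc' i); have := c2P i; lia.
Qed.

End Game.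

(** * The weight of the cops and its decrease over one round *)

Section Potential.
Variables (R : realType) (T : finType) (e : rel T) (g h t q k : nat).
Hypotheses (e_simple : simple_graph e) (e_conn : connected_graph e).
Hypothesis girth_ge : forall c, is_graph_cycle e c -> g <= size c.
Hypotheses (h_gt0 : 0 < h) (t_gt0 : 0 < t) (q_gt0 : 0 < q).
Hypothesis g_ge : 4 * h * t + 4 * h <= g + 3.
Hypothesis growth : has_growth e h q.

Variables (mu theta : R).
Hypotheses (mu_gt0 : (0 < mu)%R) (theta_gt0 : (0 < theta)%R).
Hypotheses (theta_le1 : (theta <= 1)%R) (mu_theta : (q%:R * (mu * theta) = 1)%R).
Hypothesis few_cops : (mu + (mu * theta ^+ t) *+ k <= 1)%R.

Definition front (u v x : T) : bool := dist e v x <= dist e u x.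

Definition level (v x : T) : nat := (dist e v x).+1 %/ (2 * h).

Lemma level_ge n v x : n * (2 * h) <= (dist e v x).+1 -> n <= level v x.
Proof. by rewrite /level leq_divRL ?muln_gt0. Qed.

Lemma level_lt n v x : (dist e v x).+1 < n * (2 * h) -> level v x < n.
Proof. by rewrite /level ltn_divLR ?muln_gt0. Qed.

Lemma level_gt0 v x : 4 * h <= (dist e v x).+1 -> 0 < level v x.
Proof. by move=> ?; apply: level_ge; lia. Qed.

Lemma level_pred v w x x' :
  dist e v x <= dist e w x' + 2 * h -> (level v x).-1 <= level w x'.
Proof.
move=> ?; apply: level_ge; have := leq_trunc_div (dist e v x).+1 (2 * h).
by rewrite -subn1 mulnBl mul1n -/(level v x); lia.
Qed.

Definition weight (u v x : T) : R :=
  (if front u v x then mu * theta ^+ level v x else 0)%R.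

Definition good (u v : T) (c : 'I_k -> T) : Prop :=
  [/\ e u v, forall i, c i != v,
      forall i, front u v (c i) -> 2 * h <= (dist e v (c i)).+1 &
      (\sum_i weight u v (c i) < 1)%R].

(* [x] lies beyond [w] as seen from [v], within the radius where [G] is a tree. *)
Definition target (v x w : T) : bool :=
  (dist e v x + 2 <= 2 * h * t + 2 * h) && (dist e w x + h == dist e v x).

Lemma weight_ge0 u v x : (0 <= weight u v x)%R.
Proof. by rewrite /weight; case: ifP => // _; rewrite mulr_ge0 ?exprn_ge0 ?ltW. Qed.

Lemma theta_mono m n : m <= n -> (mu * theta ^+ n <= mu * theta ^+ m)%R.
Proof. by move=> mn; rewrite ler_pM2l // ler_wiXn2l // ltW. Qed.

(** Averaging: each cop is on target for at most one of the at least [q] endpoints, so the sums over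
    all endpoints total at most [q] times the weight, which is below [q]. *)
Lemma light_direction u v c : good u v c ->
  exists w, [/\ dist e w v = h, h <= dist e w u &
    (\sum_i (if target v (c i) w then q%:R * weight u v (c i) else 0) < 1)%R].
Proof.
case=> uv _ _ lt1; pose F w i : R := (if target v (c i) w then q%:R * weight u v (c i) else 0)%R.
pose S := [set w | (dist e w v == h) && (h <= dist e w u)].
have qS : q <= #|S| by apply: growth; rewrite e_simple.1.
have [/existsP[w /andP[]]|nw] := boolP [exists w, (w \in S) && (\sum_i F w i < 1)%R].
  by rewrite inE => /andP[/eqP wv wu] ltw; exists w.
have Sge w : w \in S -> (1 <= \sum_i F w i)%R.
  by move=> wS; move/existsPn: nw => /(_ w); rewrite wS /= -leNgt.
have : (q%:R <= \sum_(w in S) \sum_i F w i :> R)%R.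
  apply: (@le_trans _ _ (\sum_(w in S) 1)%R); first by rewrite sumr_const ler_nat.
  exact: ler_sum.
rewrite exchange_big /= leNgt => /negP[].
have Fle i : (\sum_(w in S) F w i <= q%:R * weight u v (c i))%R.
  have ge0 : (0 <= q%:R * weight u v (c i))%R by rewrite mulr_ge0 ?weight_ge0.
  have [/existsP[w0 /andP[w0S w0t]]|now] := boolP [exists w, (w \in S) && target v (c i) w].
    rewrite (bigD1 w0) //= big1 ?addr0 /F ?w0t // => w /andP[wS ww0].
    case: ifP => // wt; case/eqP: ww0.
    move: w0S w0t wS wt; rewrite !inE /target => /andP[/eqP w0v _] /andP[Dle /eqP w0x].
    case/andP=> /eqP wv _ /andP[_ /eqP wx].
    exact: (target_unique e_simple e_conn girth_ge h_gt0 t_gt0 g_ge wv w0v wx w0x Dle).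
  rewrite big1 // => w wS; rewrite /F; case: ifP => // wt.
  by case/existsP: now; exists w; rewrite wS.
apply: (@le_lt_trans _ _ (\sum_i q%:R * weight u v (c i))%R); first exact: ler_sum.
by rewrite -mulr_sumr gtr_pMr // ltr0n.
Qed.

Lemma good_round u v c : good u v c -> exists2 p, 0 < size p & plan e good u v p c.
Proof.
move=> goodc; have [w [wv wu light]] := light_direction goodc.
case: goodc => uv cv frontc _.
have [p [vp lp sp]] := geodesic_ex e_conn v w.
rewrite dist_sym // wv in sp; exists p; first by rewrite sp.
have ht : h <= h * t by rewrite leq_pmulr.
have vw : h <= dist e v (last v p) by rewrite lp dist_sym // wv.
have copP i : avoids e h t u v p (c i) \/
    [/\ front u v (c i), target v (c i) w & 4 * h <= (dist e v (c i)).+1].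
  have [far|near] := leqP (2 * h * t + 2 * h) (dist e v (c i)).+1.
    by left; apply: (far_avoids e_simple e_conn h_gt0 t_gt0 g_ge).
  have Dle : dist e v (c i) + 2 <= 2 * h * t + 2 * h by move: near; lia.
  have [fr|] := boolP (front u v (c i)); last first.
    by rewrite -ltnNge => bh; left; apply: (behind_avoids e_simple e_conn girth_ge) => //; rewrite lp.
  have [tg|/eqP ntg] := eqVneq (dist e w (c i) + h) (dist e v (c i)); last first.
    left; apply: (front_avoids e_simple e_conn girth_ge) => //; [exact: frontc | by rewrite lp].
  right; split=> //; first by rewrite /target Dle tg eqxx.
  (* A targeted front cop closer than this would have level 1 and alone contribute
     [q * mu * theta = 1] to the light sum. *)
  rewrite leqNgt; apply/negP => lt4; move: light; apply/negP; rewrite -leNgt.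
  rewrite (bigD1 i) //= {1}/target Dle tg eqxx /weight fr.
  have -> : level v (c i) = 1.
    by apply/eqP; rewrite eqn_leq -ltnS level_lt ?level_ge ?mul1n ?frontc // mulnA.
  rewrite expr1 mu_theta lerDl sumr_ge0 // => j _.
  by case: ifP => // _; rewrite mulr_ge0 // weight_ge0.
have avoidp j i : j < size p -> j.+1 < dist e (c i) (nth v p j).
  move=> ltj; case: (copP i) => [[+ _]|[_ _ D4]]; first exact.
  have := dist_le_path (@take_path _ e _ _ j.+1 vp).
  rewrite (last_nth v) size_takel //= nth_take // => vj.
  by have := dist_triangle e_conn (nth v p j) v (c i); rewrite (dist_sym _ _ (c i)) //; lia.
apply: plan_of_dist => // c'; rewrite sp lp => cc'; set u' := last _ _.
have cw i : h < dist e (c i) w.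
  have := avoidp h.-1 i; rewrite sp prednK // leqnn => /(_ isT).
  by rewrite -[X in X.-1]sp nth_last lp.
have u'w : e u' w.
  rewrite /u' -lp; move: vp sp; case/lastP: (p) => [|p' z] /=; first by lia.
  by rewrite belast_rcons last_rcons rcons_path => /andP[].
have afterP i : front u' w (c' i) -> 2 * h * t <= (dist e w (c' i)).+1 \/
    [/\ front u v (c i), target v (c i) w, 4 * h <= (dist e v (c i)).+1 &
        dist e v (c i) <= dist e w (c' i) + 2 * h].
  move=> fr; case: (copP i) => [[_ /(_ _ (cc' i))]|[fr' tg D4]].
    by rewrite lp -/u' => -[lt|?]; [move: fr; rewrite /front leqNgt lt | left].
  right; split=> //; have := dist_triangle e_conn w v (c i).
  have := dist_triangle e_conn (c' i) w (c i).
  rewrite [dist e v w]dist_sym // [dist e (c' i) (c i)]dist_sym // wv.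
  by move: (cc' i); clear; lia.
split=> // [i|i fr|].
- by apply: contraTneq (cw i) => <-; rewrite -leqNgt.
- by case: (afterP i fr) => [|[_ _]]; move: ht; clear; lia.
set s := (\sum_i _)%R in light.
(* A targeted cop weighs at most [mu] times its share of [s]; any other cop in front is now at level
   at least [t]. *)
have : (\sum_i weight u' w (c' i) <= mu * s + (mu * theta ^+ t) *+ k)%R.
  have -> : ((mu * theta ^+ t) *+ k = \sum_(i < k) mu * theta ^+ t)%R.
    by rewrite sumr_const card_ord.
  rewrite mulr_sumr -big_split /=.
  apply: ler_sum => i _; rewrite {1}/weight.
  have ge0 : (0 <= mu * theta ^+ t)%R by rewrite mulr_ge0 ?exprn_ge0 ?ltW.
  have ge0' : (0 <= mu * (if target v (c i) w then q%:R * weight u v (c i) else 0))%R.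
    by rewrite mulr_ge0 ?(ltW mu_gt0) //; case: ifP => // _; rewrite mulr_ge0 // weight_ge0.
  case: ifP => [fr|_]; last exact: addr_ge0.
  case: (afterP i fr) => [Dge|[fr' tg D4 Dge]].
    by rewrite ler_wpDl // theta_mono // level_ge // mulnC.
  rewrite ler_wpDr // tg /weight fr'.
  (* The factor [q * mu], the inverse of [theta], pays exactly for the loss of one level. *)
  have -> : (mu * (q%:R * (mu * theta ^+ level v (c i))) = mu * theta ^+ (level v (c i)).-1)%R.
    by case: (level v (c i)) (level_gt0 D4) => // n _; rewrite exprS (mulrA mu theta) (mulrA q%:R%R) mu_theta mul1r.
  exact/theta_mono/level_pred.
move=> /le_lt_trans; apply; apply: lt_le_trans few_cops.
by rewrite ltrD2r gtr_pMr.
Qed.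

End Potential.

(** * Choice of the constants [mu] and [theta] *)

Lemma potential_parameters (R : realType) (t q k : nat) :
    0 < t -> 0 < q -> 0 < k ->
    (k%:R <= 1 / (expR 1 * t%:R) * q%:R ^+ t :> R)%R ->
  exists mu theta : R, [/\ (0 < mu)%R, (0 < theta)%R, (theta <= 1)%R,
    (q%:R * (mu * theta) = 1)%R & (mu + (mu * theta ^+ t) *+ k <= 1)%R].
Proof.
move=> t_gt0 q_gt0 k_gt0 kle.
have t0 : (0 < t%:R :> R)%R by rewrite ltr0n.
have q0 : (0 < q%:R :> R)%R by rewrite ltr0n.
have qt0 : (0 < q%:R ^+ t :> R)%R by rewrite exprn_gt0.
pose l : R := expR t%:R^-1.
have l0 : (0 < l)%R := expR_gt0 _.
have lt : (l ^+ t = expR 1)%R by rewrite /l -expRM_natr mulVf ?gt_eqF.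
have kl : (k%:R * (l / q%:R) ^+ t <= t%:R^-1)%R.
  rewrite expr_div_n lt mulrA ler_pdivrMr // mulrC -ler_pdivlMl ?expR_gt0 //.
  by rewrite mul1r invfM -mulrA in kle.
exists (l^-1)%R, (l / q%:R)%R; split.
- by rewrite invr_gt0.
- by rewrite divr_gt0.
(* If [theta > 1], then [q^t < e], and the bound on [k] would leave no cop at all. *)
- rewrite ler_pdivrMr // mul1r leNgt; apply/negP => ql.
  have : (q%:R ^+ t < expR 1 :> R)%R.
    by rewrite -lt ltrXn2r ?ltW //; move: t_gt0; case: (t).
  apply/negP; rewrite -leNgt.
  have k1 : (1 <= k%:R :> R)%R by rewrite ler1n.
  have t1 : (1 <= t%:R :> R)%R by rewrite ler1n.
  have := le_trans k1 kle.
  rewrite mul1r ler_pdivlMl ?mulr_gt0 ?expR_gt0 // mulr1; apply: le_trans.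
  by rewrite ler_peMr // expR_ge0.
- by rewrite mulKf ?gt_eqF // mulfV // gt_eqF.
(* As [k * theta^t <= 1/t], the claim reduces to [1 + 1/t <= exp (1/t)]. *)
- have -> : (l^-1 + l^-1 * (l / q%:R) ^+ t *+ k = l^-1 * (1 + k%:R * (l / q%:R) ^+ t))%R.
    by rewrite mulrDr mulr1 -mulrnAr mulr_natl.
  rewrite ler_pdivrMl // mulr1; apply: le_trans (expR_ge1Dx _).
  by rewrite lerD2l.
Qed.

(** * Assembling the evasion against few cops *)

Theorem theorem2p1 (R : realType) (T : finType) (e : rel T) (t h q g : nat)
    (ht : (1 <= t)%N) (hh : (1 <= h)%N) (hq : (1 <= q)%N)
    (hsimple : simple_graph e) (hconn : connected_graph e)
    (hgirth : is_girth e g) (hg : (4 * h * (t + 1) - 3 <= g)%N)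
    (hgrowth : has_growth e h q) :
  ((cop_number e)%:R > 1 / (expR 1 * t%:R) * q%:R ^+ t :> R)%R.
Proof.
have [x [y xy]] : exists x y, e x y.
  case: hgirth => -[[|x [|y c]] /andP[/andP[]] //=].
  by case/andP=> xy _ _ _ _; exists x, y.
have girth_ge := hgirth.2.
have g_ge : 4 * h * t + 4 * h <= g + 3 by move: hg; rewrite mulnDr muln1; clear; lia.
rewrite /cop_number; case: ex_minnP => k /asboolP[C legalC winC] _.
rewrite ltNge; apply/negP => kle.
(* Even a robber who never moves has to be caught by some cop. *)
have k_gt0 : 0 < k.
  have [|n [i _]] := winC (fun=> x); first by move=> n; rewrite /closed_nbr eqxx.
  exact: leq_trans (ltn_ord i).
have [mu [theta [mu0 theta0 theta1 mu_theta few]]] := potential_parameters ht hq k_gt0 kle.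
(* Safety includes positions in the middle of a round; [good_round] supplies a new round when [p] is
   used up. *)
pose safe v c := exists u p, plan e (good e h mu theta (k := k)) u v p c.
have safe_step v c : safe v c -> exists v', e v v' /\
    forall c', cops_move e c c' -> (forall i, c i != v' /\ c' i != v') /\ safe v' c'.
  have step u w p : plan e (good e h mu theta (k := k)) u v (w :: p) c ->
      exists v', e v v' /\ forall c', cops_move e c c' ->
        (forall i, c i != v' /\ c' i != v') /\ safe v' c'.
    case=> vw wp; exists w; split=> // c' /wp[free wp']; split=> //.
    by exists v, p.
  case=> u [[|w p]]; last exact: step.
  case/(good_round hsimple hconn girth_ge hh ht hq g_ge hgrowth mu0 theta0 theta1 mu_theta few).
  by case=> // w p _; apply: step.
(* The robber is taken to come from [x], where all cops stand: they are behind him and weigh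
   nothing. *)
have safe0 : safe y (fun=> x).
  have nfront : front e x y x = false.
    rewrite /front dist_self leqn0; apply/negbTE; rewrite -lt0n dist_pos //.
    by apply: contraTneq xy => ->; rewrite hsimple.2.
  exists x, [::]; split=> // [i|i|].
  - by apply: contraTneq xy => ->; rewrite hsimple.2.
  - by rewrite nfront.
  - by rewrite /weight nfront big1.
have [v safev] := safe_reach safe_step (C [::]) hconn safe0.
have [r legalr] := safe_evades safe_step legalC safev.
by apply; apply: winC.
Qed.
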